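(* There exists a $24\times 12$ binary $4$-covering array, and any two $24\times 12$ binary $4$-covering arrays are equivalent.
   Context: A binary $t$-covering array of size $m$ and degree $n$ is an $m\times n$ matrix with entries in $\{0,1\}$ such that for any $t$ distinct columns, all $2^t$ binary vectors of length $t$ occur at least once as the restriction of some row to those columns. Two binary matrices are equivalent if one can be transformed into the other by a sequence of row permutations, column permutations, and complementations of individual columns (swapping $0$ and $1$ in that column). *)

(* Defs.v *)
From mathcomp Require Import all_boot all_fingroup all_algebra.
From Stdlib Require Import Relation_Operators.

Set Implicit Arguments.
Unset Strict Implicit.
Unset Printing Implicit Defensive.

(* Binary matrices are matrices over bool (0 = false, 1 = true). *)

(* The t distinct columns are given by an injection c : 'I_t -> 'I_n. *)
Definition covering_array (t m n : nat) (A : 'M[bool]_(m, n)) : Prop :=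
  forall c : 'I_t -> 'I_n, injective c ->
  forall v : 'I_t -> bool, exists i : 'I_m, forall j : 'I_t, A i (c j) = v j.

Definition compl_col (m n : nat) (k : 'I_n) (A : 'M[bool]_(m, n)) :
    'M[bool]_(m, n) :=
  \matrix_(i, j) (if j == k then ~~ A i j else A i j).

Inductive ca_step (m n : nat) (A : 'M[bool]_(m, n)) : 'M[bool]_(m, n) -> Prop :=
  | Step_row (s : 'S_m) : ca_step A (row_perm s A)
  | Step_col (s : 'S_n) : ca_step A (col_perm s A)
  | Step_compl (k : 'I_n) : ca_step A (compl_col k A).

Definition ca_equiv (m n : nat) : 'M[bool]_(m, n) -> 'M[bool]_(m, n) -> Prop :=
  clos_refl_trans _ (@ca_step m n).

(* Main.v *)
(* In a 24 x 12 binary 4-covering array, fix two columns and a pair of entries.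
   On the rows showing that pair, the other 10 columns are pairwise
   qualitatively independent, which takes at least 6 rows, and with exactly 6
   rows forces each of these columns to be balanced.  So all counts are tight,
   and the array is an orthogonal array of strength 3.  In +-1 form, its columns
   together with their products by one fixed column are the 24 columns of a
   Hadamard matrix of order 24; hence two distinct rows are either opposite or at
   Hamming distance 6, and the rows are closed under complementation.

   Normalize two rows to 0^12 and 1^6 0^6.  On the first six columns the rows are
   then 0^6 and 1^6, twice each, and each pattern of weight 3 once.  Each of the
   last six columns is one of 12 vectors orthogonal to the first six (the 12
   pentagons in K_5), and the six of them form one of two cliques of pairwise
   orthogonal vectors, which are exchanged by a transposition of the first six
   columns. *)
Require Import Defs.
From mathcomp Require Import all_boot all_fingroup all_algebra.
From mathcomp Require Import zify ring.
From Stdlib Require Import Relation_Operators.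

Set Implicit Arguments.
Unset Strict Implicit.
Unset Printing Implicit Defensive.
Import GRing.Theory Num.Theory.

(** * Exhaustive search for cliques of given size *)

Section Cliques.
Variables (T : eqType) (adj : rel T).

(** The recursion is on [n] outside and on [l] inside, since the filtered list is not a subterm of
    [l]. The test on [size l'] prunes branches with too few vertices left. *)
Fixpoint cliques n (l : seq T) : seq (seq T) :=
  if n is n'.+1 then
    (fix ext l := if l is x :: l' then
       if size l' < n' then [::] else
       [seq x :: c | c <- cliques n' (filter (adj x) l')] ++ ext l'
     else [::]) l
  else [:: [::]].

Lemma mem_cliques l s :
  subseq s l -> pairwise adj s -> s \in cliques (size s) l.
Proof.
elim: s l => [|x s IHs] l //=; elim: l => [|y l IHl] //= sub /andP[adjx adjs].
case: ltnP sub => [lt_ls | _] sub.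
  have := size_subseq (s1 := x :: s) (s2 := y :: l) sub.
  by rewrite /= ltnS leqNgt lt_ls.
rewrite mem_cat; move: sub; case: eqP => [<- | _] sub; apply/orP; [left | right].
  by rewrite map_f // IHs // subseq_filter adjx.
by apply: IHl; rewrite ?adjx.
Qed.

(** Listed in the order of [l], the set [s] becomes a subsequence of [l], so the search meets it. *)
Lemma cliquesP l s : uniq l -> uniq s -> {subset s <= l} ->
  {in s &, forall x y, x != y -> adj x y} ->
  exists2 c, c \in cliques (size s) l & perm_eq s c.
Proof.
move=> Ul Us sub adjs; pose c := [seq x <- l | x \in s].
have sc : perm_eq s c.
  apply: uniq_perm => // [|x]; first exact: filter_uniq.
  rewrite mem_filter; case: (boolP (x \in s)) => //= /sub ->//.
exists c => //; rewrite (perm_size sc) mem_cliques ?filter_subseq //.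
have : uniq c by exact: filter_uniq.
rewrite uniq_pairwise; apply: (sub_in_pairwise (P := mem s)).
  by move=> x y; exact: adjs.
by apply/allP=> x; rewrite mem_filter => /andP[].
Qed.
End Cliques.

(** * Pairwise qualitatively independent vectors of length 6 *)

Fixpoint bitseqs n : seq bitseq :=
  if n is n'.+1 then [seq false :: s | s <- bitseqs n'] ++
                     [seq true :: s | s <- bitseqs n'] else [:: [::]].

Lemma mem_bitseqs n s : (s \in bitseqs n) = (size s == n).
Proof.
elim: n s => [|n IHn] [|b s] //=; rewrite ?mem_cat.
  by apply/norP; split; apply/mapP => -[].
have cons_inj (c : bool) : injective (cons c) by move=> ? ? [] .
case: b; rewrite (mem_map (cons_inj _)) IHn eqSS.
  by rewrite orb_idl // => /mapP[].
by rewrite orb_idr // => /mapP[].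
Qed.

Lemma bitseqs_uniq n : uniq (bitseqs n).
Proof.
elim: n => //= n IHn.
rewrite cat_uniq !map_inj_uniq ?IHn => [|? ? [] //|? ? [] //].
by rewrite andbT; apply/hasPn => _ /mapP[s _ ->]; apply/mapP => -[].
Qed.

Definition independent (u v : bitseq) :=
  all (mem (zip u v)) [seq (a, b) | a <- [:: false; true], b <- [:: false; true]].

Lemma independentP u v :
  reflect (forall a b, (a, b) \in zip u v) (independent u v).
Proof.
apply: (iffP allP) => [H a b | H [a b] _]; last exact: H.
by apply: H; apply/allpairsP; exists (a, b); case: a; case: b.
Qed.

Lemma independent_irr u : ~~ independent u u.
Proof.
apply/negP => /independentP/(_ false true).
by elim: u => //= b u IHu; rewrite in_cons; case: b.
Qed.

(** Normalizes the first bit to 0, which halves the search space; independence and balance survive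
    complementation. *)
Definition complement (u : bitseq) := map (addb (head false u)) u.

Lemma independent_complement u v :
  independent u v -> independent (complement u) (complement v).
Proof.
move=> /independentP uv; apply/independentP => a b.
set c := head false u; set d := head false v.
have zipE : zip (complement u) (complement v) =
    [seq (c (+) p.1, d (+) p.2) | p <- zip u v].
  rewrite /complement -/c -/d; move: c d => {uv} c d.
  by elim: u v => [|x u IHu] [|y v] //=; rewrite IHu.
by rewrite zipE; apply/mapP; exists (c (+) a, d (+) b); rewrite //= !addKb.
Qed.

Definition head0_bitseqs6 := [seq false :: s | s <- bitseqs 5].

Lemma mem_complement u : size u = 6 -> complement u \in head0_bitseqs6.
Proof.
case: u => // b u [size_u]; rewrite /complement /= addbb map_f //.
by rewrite mem_bitseqs size_map size_u.
Qed.

(** The 9 vectors sought among the neighbours of [v] are the rest of a family of 10; the search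
    finds none around an unbalanced [v]. *)
Lemma no_unbalanced_clique :
  all (fun v => (count id v == 3) ||
    nilp (cliques independent 9 (filter (independent v) head0_bitseqs6)))
    head0_bitseqs6.
Proof. by vm_compute. Qed.

(* The case of a 6-element set of the Katona / Kleitman--Spencer theorem. *)
Lemma balanced_independent (I : eqType) (s : seq I) (F : I -> bitseq) :
    uniq s -> size s = 10 -> {in s, forall k, size (F k) = 6} ->
    {in s &, forall k l, k != l -> independent (F k) (F l)} ->
  {in s, forall k, count id (F k) = 3}.
Proof.
move=> Us size_s sizeF indF k ks; pose G l := complement (F l).
have GP l : l \in s -> G l \in head0_bitseqs6.
  by move=> ls; rewrite mem_complement ?sizeF.
have indG : {in s &, forall l m, l != m -> independent (G l) (G m)}.
  by move=> l m ls ms lm; apply/independent_complement/indF.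
have [r def_r] : {r | r = rem k s} by exists (rem k s).
have rs l : l \in r -> (l \in s) * (l != k).
  by rewrite def_r mem_rem_uniq // inE => /andP[].
have Ul : uniq (filter (independent (G k)) head0_bitseqs6).
  by rewrite filter_uniq // map_inj_uniq ?bitseqs_uniq // => ? ? [].
(* No vector is independent of itself, so distinct indices keep distinct vectors. *)
have Ur : uniq (map G r).
  rewrite map_inj_in_uniq ?def_r ?rem_uniq // -def_r => l m /rs[ls _] /rs[ms _] eqG.
  apply/eqP/contraT => lm.
  by have := indG l m ls ms lm; rewrite eqG (negbTE (independent_irr _)).
have /orP[/eqP bal | /nilP no_clique] := allP no_unbalanced_clique _ (GP k ks).
  move: bal (sizeF k ks); rewrite /G; case: (F k) => // b u /=.
  rewrite addbb /= add0n; case: b => [+ [size_u]|]; last first.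
    by rewrite (eq_map addFb) map_id.
  rewrite count_map (eq_count (a2 := predC id)) // => cN.
  by move: size_u; rewrite -(count_predC id u) cN => /(@addIn 3 _ 2) ->.
(* The nine other vectors would form a clique among the neighbours of [G k]. *)
have [||c] := cliquesP (adj := independent) Ul Ur.
- move=> _ /mapP[l /rs[ls lk] ->]; rewrite mem_filter GP //.
  by rewrite indG // eq_sym.
- move=> _ _ /mapP[l /rs[ls _] ->] /mapP[m /rs[ms _] ->] neqG.
  by apply: indG => //; apply: contraNneq neqG => ->.
by rewrite size_map def_r size_rem // size_s no_clique.
Qed.

(** * From 4-coverage to strength 3 and to the distances between rows *)

Lemma covering4 m n (A : 'M[bool]_(m, n)) (k1 k2 k3 k4 : 'I_n) (a b c d : bool) :
    covering_array 4 A -> uniq [:: k1; k2; k3; k4] ->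
  exists i, [/\ A i k1 = a, A i k2 = b, A i k3 = c & A i k4 = d].
Proof.
move=> CA U; have /tuple_uniqP inj_k : uniq [tuple k1; k2; k3; k4] by [].
have [i Ai] := CA _ inj_k (tnth [tuple a; b; c; d]).
exists i; split; [apply: (Ai 0%R) | apply: (Ai 1%R) |
  apply: (Ai 2%R) | apply: (Ai 3%R)].
Qed.

Definition sign (b : bool) : int := ((-1) ^+ b)%R.

Lemma signMM b : (sign b * sign b = 1)%R.
Proof. by case: b. Qed.

Section Strength3.
Variable A : 'M[bool]_(24, 12).
Hypothesis CA : covering_array 4 A.

Section Pair.
Variables (k1 k2 : 'I_12).
Hypothesis k12 : k1 != k2.

Definition block a b := [seq i <- enum 'I_24 | (A i k1, A i k2) == (a, b)].

(* Whatever bit [e] is used to fill a short block up to 6 rows, its columns stay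
   independent, hence balanced; so there is nothing to fill. *)
Definition padded a b e k :=
  [seq A i k | i <- block a b] ++ nseq (6 - size (block a b)) e.

(** By 4-coverage, the other ten columns are pairwise independent already on the rows of the block,
    and padding only adds rows. *)
Lemma count_padded a b e k : k != k1 -> k != k2 -> size (block a b) <= 6 ->
  count id (padded a b e k) = 3.
Proof.
move=> kk1 kk2 small; pose s := [seq k <- enum 'I_12 | (k != k1) && (k != k2)].
have sP l : (l \in s) = (l != k1) && (l != k2) by rewrite mem_filter mem_enum andbT.
apply: (@balanced_independent _ s (padded a b e)).
- by rewrite filter_uniq ?enum_uniq.
- have := count_predC (mem [:: k1; k2]) (enum 'I_12).
  have -> : count (mem [:: k1; k2]) (enum 'I_12) = 2.
    rewrite -size_filter -/(size [:: k1; k2]); apply/perm_size/uniq_perm.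
    + by rewrite filter_uniq ?enum_uniq.
    + by rewrite /= inE k12.
    by move=> l; rewrite mem_filter mem_enum andbT.
  rewrite size_enum_ord size_filter => -[E]; rewrite -[RHS]E; apply: eq_count => l.
  by rewrite /= !inE negb_or.
- by move=> l _; rewrite size_cat size_map size_nseq subnKC.
- move=> l m; rewrite !sP => /andP[l1 l2] /andP[m1 m2] lm.
  apply/independentP => c d.
  have [|i [i1 i2 il im]] := @covering4 _ _ _ k1 k2 l m a b c d CA.
    by rewrite /= !inE !negb_or k12 lm !(eq_sym k1) !(eq_sym k2) l1 l2 m1 m2.
  rewrite zip_cat ?size_map // mem_cat; apply/orP; left.
  have iB : i \in block a b by rewrite mem_filter i1 i2 eqxx mem_enum.
  rewrite -il -im; elim: (block a b) iB => //= j B IHB.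
  by rewrite !inE => /predU1P[-> | /IHB->]; rewrite ?eqxx ?orbT.
- by rewrite sP kk1 kk2.
Qed.

Lemma exists_other : exists2 k, k != k1 & k != k2.
Proof.
have : 0 < #|[predC [:: k1; k2]]|.
  rewrite -(ltn_add2l #|[:: k1; k2]|) cardC card_ord addn0.
  by rewrite (leq_ltn_trans (card_size _)).
by case/card_gt0P => k; rewrite !inE negb_or => /andP[]; exists k.
Qed.

Lemma size_block_ge a b : 6 <= size (block a b).
Proof.
have [k kk1 kk2] := exists_other; case: (ltnP 6 (size (block a b))) => [/ltnW// | le6].
have := etrans (count_padded false kk1 kk2 le6) (esym (count_padded true kk1 kk2 le6)).
rewrite !count_cat !count_nseq mul0n mul1n => /addnI/esym/eqP.
by rewrite subn_eq0.
Qed.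

(** Four blocks of at least 6 rows share the 24 rows. *)
Lemma size_block a b : size (block a b) = 6.
Proof.
have : size (block false false) + size (block false true)
     + size (block true false) + size (block true true) = 24.
  rewrite -[in RHS](size_enum_ord 24) /block.
  elim: (enum _) => //= i s <-.
  by case: (A i k1); case: (A i k2); rewrite /= ?addSn ?addnS.
move: (size_block_ge false false) (size_block_ge false true)
  (size_block_ge true false) (size_block_ge true true).
by case: a; case: b; lia.
Qed.

Lemma count_block a b k : k != k1 -> k != k2 ->
  count (fun i => A i k) (block a b) = 3.
Proof.
move=> kk1 kk2; have := count_padded false kk1 kk2 (eq_leq (size_block a b)).
by rewrite /padded size_block subnn cats0 count_map.
Qed.
End Pair.

(** Strength 3 with index 3: each triple of entries fills half of a block of six rows. *)
Lemma sum_triple (V : nmodType) (F : bool -> bool -> bool -> V) k1 k2 k3 :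
    uniq [:: k1; k2; k3] ->
  (\sum_i F (A i k1) (A i k2) (A i k3) =
   \sum_(a : bool) \sum_(b : bool) \sum_(c : bool) F a b c *+ 3)%R.
Proof.
rewrite /= !inE negb_or andbT => /andP[/andP[k12 k13] k23].
pose occ i a b c := (A i k3 == c) && ((A i k1, A i k2) == (a, b)).
rewrite (eq_bigr (fun i => \sum_(a : bool) \sum_(b : bool) \sum_(c : bool)
   F a b c *+ occ i a b c)%R); last first.
  move=> i _; rewrite !big_bool /occ; case: (A i k1); case: (A i k2); case: (A i k3);
     by rewrite /= ?(addr0, add0r).
rewrite exchange_big; apply: eq_bigr => a _.
rewrite exchange_big; apply: eq_bigr => b _.
rewrite exchange_big; apply: eq_bigr => c _.
have size6 := size_block k12 a b.
have count3 : count (fun i => A i k3) (block k1 k2 a b) = 3.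
  by apply: count_block; rewrite // eq_sym.
have {size6} count3c : count (fun i => A i k3 == c) (block k1 k2 a b) = 3.
  move: (count_predC (fun i => A i k3) (block k1 k2 a b)).
  rewrite size6 count3 => -[count3N].
  case: c; [rewrite -[RHS]count3 | rewrite -[RHS]count3N];
    by apply: eq_count => i /=; case: (A i k3).
rewrite sumrMnr -[in RHS]count3c count_filter -sum1_count big_enum_cond.
rewrite [in RHS]big_mkcond /=.
by congr (_ *+ _)%R; apply: eq_bigr => i _; rewrite /occ; case: (_ && _).
Qed.

Lemma sum_sign1 k : (\sum_i sign (A i k) = 0)%R.
Proof.
have [l lk _] := exists_other k k; have [m mk ml] := exists_other k l.
rewrite (@sum_triple _ (fun a _ _ => sign a) k l m) ?big_bool //=.
by rewrite !inE negb_or (eq_sym k l) (eq_sym k m) (eq_sym l m) lk mk ml.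
Qed.

(** Two equal indices cancel and leave one balanced column; for distinct indices this is strength 3.
    It is the orthogonality of a column to a product of two columns. *)
Lemma sum_sign3 k1 k2 k3 :
  (\sum_i sign (A i k1) * sign (A i k2) * sign (A i k3) = 0)%R.
Proof.
have [<- | k12] := eqVneq k1 k2.
  by rewrite -[RHS](sum_sign1 k3); apply: eq_bigr => i _; rewrite signMM mul1r.
have [<- | k13] := eqVneq k1 k3.
  by rewrite -[RHS](sum_sign1 k2); apply: eq_bigr => i _; rewrite mulrAC signMM mul1r.
have [<- | k23] := eqVneq k2 k3.
  by rewrite -[RHS](sum_sign1 k1); apply: eq_bigr => i _; rewrite -mulrA signMM mulr1.
rewrite (@sum_triple _ (fun a b c => sign a * sign b * sign c)%R k1 k2 k3) ?big_bool //=.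
by rewrite !inE negb_or k12 k13 k23.
Qed.

Lemma sum_sign2 k l : (\sum_i sign (A i k) * sign (A i l) = 24 *+ (k == l))%R.
Proof.
have [<- | kl] := eqVneq k l.
  by rewrite (eq_bigr (fun=> 1%R)) ?sumr_const ?card_ord // => i _; rewrite signMM.
have [m mk ml] := exists_other k l.
rewrite (@sum_triple _ (fun a b _ => sign a * sign b)%R k l m) ?big_bool //=.
by rewrite !inE negb_or (eq_sym k m) (eq_sym l m) kl mk ml.
Qed.

Lemma sum_addb_col k l : k != l -> \sum_i (A i k (+) A i l) = 12.
Proof.
move=> kl; have [m mk ml] := exists_other k l.
rewrite [LHS](@sum_triple _ (fun a b _ => (a (+) b : nat)) k l m) ?big_bool //=.
by rewrite !inE negb_or (eq_sym k m) (eq_sym l m) kl mk ml.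
Qed.

Definition row_dot x y : int := (\sum_j sign (A x j) * sign (A y j))%R.

Lemma row_dot_diag x : row_dot x x = 12%R.
Proof.
rewrite /row_dot (eq_bigr (fun=> 1%R)) ?sumr_const ?card_ord // => i _.
exact: signMM.
Qed.

(* The sum over all rows [y] of [(1 + x_k y_k) <x, y> ^ 2] equals the
   contribution of [y = x], so all other terms vanish. *)
Lemma row_dot_eq0 x y k : x != y -> A x k = A y k -> row_dot x y = 0%R.
Proof.
move=> xy xyk; pose w z := (1 + sign (A x k) * sign (A z k))%R : int.
have w_ge0 z : (0 <= w z)%R by rewrite /w; case: (A x k); case: (A z k).
(* After expanding and summing over the rows first, only the 12 diagonal terms [i = j] survive, each
   equal to 24. *)
have total : (\sum_z w z * (row_dot x z * row_dot x z) = 288)%R.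
  transitivity (\sum_i \sum_j sign (A x i) * sign (A x j) *
    (\sum_z sign (A z i) * sign (A z j) +
     sign (A x k) * \sum_z sign (A z k) * sign (A z i) * sign (A z j)))%R.
    under eq_bigr => z _.
      rewrite {1}/row_dot big_distrl /= big_distrr /=.
      under eq_bigr => i _ do rewrite /row_dot 2!big_distrr /=.
      over.
    rewrite exchange_big; apply: eq_bigr => i _ /=.
    rewrite exchange_big; apply: eq_bigr => j _ /=.
    rewrite [in RHS]big_distrr -big_split [in RHS]big_distrr /=.
    by apply: eq_bigr => z _; rewrite /w; ring.
  under eq_bigr => i _.
    under eq_bigr => j _ do rewrite sum_sign2 sum_sign3 mulr0 addr0.
    rewrite (bigD1 i) //= eqxx signMM mul1r big1 => [|j ji].
      over.
    by rewrite eq_sym (negbTE ji) mulr0n mulr0.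
  by rewrite sumr_const card_ord.
(* The row [x] alone contributes [2 * 12 ^ 2 = 288]. *)
have rest0 : (\sum_(z | z != x) w z * (row_dot x z * row_dot x z) = 0)%R.
  apply: (addrI 288%R); rewrite addr0 -[RHS]total [in RHS](bigD1 x) //=.
  by rewrite row_dot_diag /w signMM.
have term_ge0 z : z != x -> (0 <= w z * (row_dot x z * row_dot x z))%R.
  by move=> _; rewrite mulr_ge0 ?w_ge0 // -expr2 sqr_ge0.
have /eqP : (w y * (row_dot x y * row_dot x y) = 0)%R.
  by apply: (psumr_eq0P term_ge0 rest0); rewrite eq_sym.
by rewrite /w -xyk signMM mulf_eq0 orFb mulf_eq0 orbb => /eqP.
Qed.

(** Rows that agree somewhere are orthogonal, and the dot product is 12 minus twice the distance.
    Rows that agree nowhere are opposite. *)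
Lemma row_distance x y : x != y ->
  \sum_j (A x j (+) A y j) = 6 \/ forall j, A y j = ~~ A x j.
Proof.
move=> xy; have [/existsP[k /eqP xyk] | /existsPn diff] :=
  boolP [exists k, A x k == A y k]; last first.
  by right=> j; move: (diff j); case: (A x j); case: (A y j).
left; have := row_dot_eq0 xy xyk.
have -> : row_dot x y = (12 - 2 * (\sum_j (A x j (+) A y j))%:R)%R.
  rewrite /row_dot (eq_bigr (fun j => 1 - 2 * (A x j (+) A y j)%:R)%R); last first.
    by move=> j _; case: (A x j); case: (A y j).
  by rewrite sumrB sumr_const card_ord natr_sum big_distrr.
by lia.
Qed.

(** Columns are balanced, so the dot products of [x] with all rows add up to 0; without an opposite
    row only the term 12 of [x] itself would remain. *)
Lemma exists_antipode x : exists y, forall j, A y j = ~~ A x j.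
Proof.
have [/existsP[y /forallP yP] | /existsPn no] :=
  boolP [exists y, forall j, A y j == ~~ A x j].
  by exists y => j; apply/eqP.
have total : (\sum_y row_dot x y = 0)%R.
  rewrite exchange_big big1 // => j _; rewrite -big_distrr /=.
  by rewrite sum_sign1 mulr0.
move: total; rewrite (bigD1 x) //= row_dot_diag big1 => // y yx.
have /forallPn[j neq] := no y; apply: (@row_dot_eq0 _ _ j); first by rewrite eq_sym.
by move: neq; case: (A x j); case: (A y j).
Qed.

End Strength3.

(** * The first six columns in normal form and the candidates for the others *)

Definition hamming (u v : bitseq) := count (fun p => p.1 (+) p.2) (zip u v).

(* Since [bitseqs] is in lexicographic order, positions [i] and [23 - i] hold
   complementary patterns. *)
Definition patterns : seq bitseq :=
  let ends := [:: nseq 6 false; nseq 6 true] in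
  ends ++ [seq p <- bitseqs 6 | count id p == 3] ++ ends.

Definition pattern_cols : seq bitseq :=
  [seq [seq nth false p j | p <- patterns] | j <- iota 0 6].

(** With [h] of length 12, positions [i] and [23 - i] hold opposite bits, as opposite rows
    require. *)
Definition antisym_col (h : bitseq) := h ++ rev (map negb h).

(** The two leading zeros come from the rows 0^12 and 1^6 0^6. The ten free bits, one for each pair
    of complementary triples, are the edges of K_5; the filter keeps the pentagons. *)
Definition col_candidates : seq bitseq :=
  [seq v <- [seq antisym_col [:: false, false & w] | w <- bitseqs 10]
     | all (fun c => hamming c v == 12) pattern_cols].

(** Orthogonality in +-1 form, for columns of length 24. *)
Definition half_apart u v := hamming u v == 12.

Definition completions := cliques half_apart 6 col_candidates.

Lemma size_completions : size completions = 2.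
Proof. by vm_compute. Qed.

Definition mx_of_cols (cs : seq bitseq) : 'M[bool]_(24, 12) :=
  (\matrix_(i, j) nth false (nth [::] cs j) i)%R.

Definition rows_of_cols cs := [seq [seq nth false c i | c <- cs] | i <- iota 0 24].

(** * Equivalence of arrays *)

Section Equiv.
Variables m n : nat.
Implicit Types A B C : 'M[bool]_(m, n).

Lemma ca_equiv_refl A : ca_equiv A A.
Proof. exact: rt_refl. Qed.

Lemma ca_equiv_trans A B C : ca_equiv A B -> ca_equiv B C -> ca_equiv A C.
Proof. exact: rt_trans. Qed.

Lemma compl_colK k : involutive (@compl_col m n k).
Proof.
by move=> A; apply/matrixP => i j; rewrite !mxE; case: eqP => // _; rewrite negbK.
Qed.

Lemma ca_equiv_sym A B : ca_equiv A B -> ca_equiv B A.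
Proof.
elim=> {A B} [A _ [s|s|k] | A | A B C _ BA _ CB]; last 2 first.
- exact: ca_equiv_refl.
- exact: ca_equiv_trans BA.
- rewrite -{2}(row_perm1 A) -(mulVg s) row_permM; apply/rt_step/Step_row.
- rewrite -{2}(col_perm1 A) -(mulVg s) col_permM; apply/rt_step/Step_col.
- by rewrite -{2}(compl_colK k A); apply/rt_step/Step_compl.
Qed.

Lemma covering_array_equiv t A B :
  ca_equiv A B -> covering_array t A -> covering_array t B.
Proof.
elim=> {A B} [A _ [s|s|k] | // | A B C _ IHA _ IHB /IHA/IHB//] CA c inj_c v.
- have [i Ai] := CA c inj_c v; exists ((s^-1)%g i) => j.
  by rewrite mxE permKV Ai.
- have [|i Ai] := CA (s \o c) _ v; first exact: inj_comp perm_inj inj_c.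
  by exists i => j; rewrite mxE -Ai.
- have [i Ai] := CA c inj_c (fun j => v j (+) (c j == k)).
  by exists i => j; rewrite mxE Ai; case: eqP => _; case: (v j).
Qed.

Lemma ca_equiv_compl (p : pred 'I_n) A :
  ca_equiv A (\matrix_(i, j) (A i j (+) p j))%R.
Proof.
pose B s := foldr (@compl_col m n) A s.
have AB s : ca_equiv A (B s).
  elim: s => [|k s IHs]; first exact: ca_equiv_refl.
  apply: ca_equiv_trans IHs _; exact/rt_step/Step_compl.
have BE s : uniq s -> forall i j, B s i j = A i j (+) (j \in s).
  elim: s => [_ i j|k s IHs /andP[ks Us] i j]; first by rewrite addbF.
  rewrite mxE IHs // inE; case: eqP => [-> | _] //=.
  by rewrite (negbTE ks) addbF addbT.
have -> : (\matrix_(i, j) (A i j (+) p j))%R = B (enum p); last exact: AB.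
by apply/matrixP => i j; rewrite mxE BE ?enum_uniq // mem_enum.
Qed.
End Equiv.

Lemma ca_equiv_cols (A : 'M[bool]_(24, 12)) cs :
  perm_eq cs [tuple ([tuple A i j | i < 24] : bitseq) | j < 12] ->
  ca_equiv A (mx_of_cols cs).
Proof.
case/tuple_permP => p def_cs.
have -> : mx_of_cols cs = col_perm p A; last exact/rt_step/Step_col.
apply/matrixP => i j; rewrite !mxE def_cs nth_mktuple tnth_mktuple.
by rewrite nth_mktuple.
Qed.

(** Reduces equivalence by a row permutation to a comparison of closed lists, which can be
    computed. *)
Lemma ca_equiv_rows cs cs' : size cs = 12 -> size cs' = 12 ->
  perm_eq (rows_of_cols cs) (rows_of_cols cs') ->
  ca_equiv (mx_of_cols cs') (mx_of_cols cs).
Proof.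
move=> size_cs size_cs'.
have -> : rows_of_cols cs' = [tuple [seq nth false c i | c <- cs'] | i < 24].
  by rewrite /rows_of_cols -val_enum_ord -map_comp.
case/tuple_permP => p rowsE.
have -> : mx_of_cols cs = row_perm p (mx_of_cols cs'); last exact/rt_step/Step_row.
apply/matrixP => i j; rewrite !mxE.
have : nth [::] (rows_of_cols cs) i = [seq nth false c (p i) | c <- cs'].
  by rewrite rowsE nth_mktuple tnth_mktuple.
rewrite (nth_map 0) ?size_iota // nth_iota // => /(congr1 (nth false ^~ j)).
by rewrite !(nth_map [::]) ?size_cs ?size_cs'.
Qed.

(** * The two base arrays *)

Definition base_cols k := pattern_cols ++ nth [::] completions k.

Lemma size_base_cols k : k < 2 -> size (base_cols k) = 12.
Proof. by case: k => [|[|//]] _; vm_cast_no_check (erefl 12). Qed.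

Lemma ca_equiv_swap a b cs :
  ca_equiv (mx_of_cols [:: a, b & cs]) (mx_of_cols [:: b, a & cs]).
Proof.
have -> : mx_of_cols [:: b, a & cs] =
    col_perm (tperm 0%R 1%R) (mx_of_cols [:: a, b & cs]); last exact/rt_step/Step_col.
apply/matrixP => i j; rewrite !mxE; congr (nth _ _ _).
case: tpermP => [->|->|] //; case: j => [[|[|j]] lt_j] //=.
- by case; apply: val_inj.
- by move=> _; case; apply: val_inj.
Qed.

(** After transposing the first two columns of one array, the two arrays have the same rows up to
    order. *)
Lemma base_equiv : ca_equiv (mx_of_cols (base_cols 1)) (mx_of_cols (base_cols 0)).
Proof.
pose swap (cs : seq bitseq) := if cs is [:: a, b & s] then [:: b, a & s] else cs.
have : perm_eq (rows_of_cols (swap (base_cols 0))) (rows_of_cols (base_cols 1)).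
  by vm_cast_no_check (erefl true).
have := size_base_cols (ltnSn 1); have := @size_base_cols 0 isT.
move: (base_cols 0) (base_cols 1) => [|a [|b cs]] // cs1 size0 size1 rows01.
apply: ca_equiv_trans (ca_equiv_rows _ _ rows01) (ca_equiv_swap _ _ _) => //.
Qed.

Definition proj (c : seq nat) (r : bitseq) := [seq nth false r k | k <- c].

(** The cliques of the complete graph enumerate the 4-subsets of the columns. *)
Lemma base_covering_check :
  all (fun c => all (mem [seq proj c r | r <- rows_of_cols (base_cols 0)])
    (bitseqs 4)) (cliques (fun _ _ => true) 4 (iota 0 12)).
Proof. by vm_cast_no_check (erefl true). Qed.

Lemma base_covering : covering_array 4 (mx_of_cols (base_cols 0)).
Proof.
move=> c inj_c v; pose s := [seq val (c j) | j <- enum 'I_4].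
have Us : uniq s by rewrite map_inj_uniq ?enum_uniq // => i j /val_inj/inj_c.
have size_s : size s = 4 by rewrite size_map size_enum_ord.
have [||c' c'4 s_c'] := @cliquesP _ (fun _ _ => true) (iota 0 12) s (iota_uniq _ _) Us.
- by move=> _ /mapP[j _ ->]; rewrite mem_iota /=.
- by [].
(* [f] carries the prescribed entries from the injection [c] to the enumerated list [c'] of the same
   columns. *)
rewrite size_s in c'4; pose f k := [exists j, (val (c j) == k) && v j].
have /mapP[r] : [seq f k | k <- c'] \in [seq proj c' r | r <- rows_of_cols (base_cols 0)].
  apply: (allP (allP base_covering_check c' c'4)).
  by rewrite mem_bitseqs size_map -(perm_size s_c') size_s.
move: (base_cols 0) (@size_base_cols 0 isT) => cs size_cs.
case/mapP => i; rewrite mem_iota add0n => /= lt_i -> /eq_in_map fE.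
exists (Ordinal lt_i) => j; rewrite mxE.
have cj : val (c j) \in c'.
  by rewrite -(perm_mem s_c'); apply/mapP; exists j; rewrite ?mem_enum.
transitivity (f (val (c j))).
  by rewrite fE // (nth_map [::]) ?size_cs ?ltn_ord.
rewrite /f; apply/existsP/idP => [[k /andP[/eqP/val_inj/inj_c -> //]] | vj].
by exists j; rewrite eqxx.
Qed.

(** * Rows of a normalized array and their keys *)

Lemma hamming_mktuple n (f g : 'I_n -> bool) :
  hamming (mktuple f) (mktuple g) = \sum_j (f j (+) g j).
Proof.
rewrite /hamming /= -big_enum /=; elim: (enum 'I_n) => [|j s IHs] /=.
  by rewrite big_nil.
by rewrite big_cons -IHs.
Qed.

Lemma hamming_xx u : hamming u u = 0.
Proof. by elim: u => //= b u IHu; rewrite /hamming /= addbb. Qed.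

Definition row_bits (A : 'M[bool]_(24, 12)) i : bitseq := [tuple A i j | j < 12].
Definition col_bits (A : 'M[bool]_(24, 12)) j : bitseq := [tuple A i j | i < 24].

Lemma size_row_bits A i : size (row_bits A i) = 12.
Proof. exact: size_tuple. Qed.

Lemma hamming_row_bits A x y : covering_array 4 A -> x != y ->
  hamming (row_bits A x) (row_bits A y) \in [:: 6; 12].
Proof.
move=> CA xy; rewrite hamming_mktuple.
have [-> // | opp] := row_distance CA xy.
rewrite (eq_bigr (fun=> 1)) ?sum1_card ?card_ord // => j _.
by rewrite opp addbN addbb.
Qed.

Definition half_row : bitseq := nseq 6 true ++ nseq 6 false.

Definition good (r : bitseq) :=
  all (fun u => hamming u r \in [:: 0; 6; 12]) [:: nseq 12 false; half_row].

(* The second component only serves to separate the two occurrences of 0^6 and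
   of 1^6; it is [false] when the first component has weight 3. *)
Definition key (r : bitseq) := (take 6 r, all id (drop 6 r)).

Definition keys := zip patterns (nseq 22 false ++ nseq 2 true).

Definition unkey (k : bitseq * bool) : bitseq := k.1 ++ nseq 6 k.2.

(** The effect on the key of complementing a good row: the flag flips on 0^6 and 1^6, and stays
    [false] on weight 3. *)
Definition key_opp (k : bitseq * bool) :=
  (map negb k.1, (count id k.1 != 3) && ~~ k.2).

(** The distances to 0^12 and 1^6 0^6 leave two cases: both halves of the row have weight 3, or both
    are constant and the key determines the row. *)
Lemma good_rows_check :
  all (fun r => [&& key r \in keys, key (map negb r) == key_opp (key r)
    & (count id (key r).1 == 3) || (r == unkey (key r))])
    [seq r <- bitseqs 12 | good r].
Proof. by vm_compute. Qed.

(** Opposite keys stand at positions [i] and [23 - i], whence the antisymmetry of sorted columns. *)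
Lemma keys_check : uniq keys && (map key_opp keys == rev keys).
Proof. by vm_compute. Qed.

Lemma size_keys : size keys = 24.
Proof. by vm_compute. Qed.

Lemma goodP r : size r = 12 -> good r -> [/\ key r \in keys,
  key (map negb r) = key_opp (key r) & count id (key r).1 = 3 \/ r = unkey (key r)].
Proof.
move=> size_r good_r; have := allP good_rows_check r.
rewrite mem_filter good_r mem_bitseqs size_r => /(_ isT) /and3P[-> /eqP->].
by case/orP=> /eqP; split; auto.
Qed.

Lemma weight3_support (p : bitseq) : count id p = 3 -> exists a b c,
  [/\ uniq [:: a; b; c], all (gtn (size p)) [:: a; b; c]
    & all (nth false p) [:: a; b; c]].
Proof.
rewrite -{1}(mkseq_nth false p) count_map -size_filter.
set s := filter _ _ => size_s.
have Us : uniq s by rewrite filter_uniq ?iota_uniq.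
have sP k : k \in s -> (k < size p) && nth false p k.
  by rewrite mem_filter mem_iota andbC.
have s1 : all (gtn (size p)) s by apply/allP => k /sP/andP[].
have s2 : all (nth false p) s by apply/allP => k /sP/andP[].
clearbody s; case: s size_s Us s1 s2 {sP} => [|a [|b [|c []]]] // _ Us s1 s2.
by exists a, b, c.
Qed.

Section Normalized.
Variable A : 'M[bool]_(24, 12).
Hypothesis CA : covering_array 4 A.
Variable y : 'I_24.
Hypothesis A0 : forall j, A 0%R j = false.
Hypothesis Ay : forall j : 'I_12, A y j = (j < 6).

Lemma row_bits0 : row_bits A 0%R = nseq 12 false.
Proof.
apply: (@eq_from_nth _ false) => [|j]; rewrite ?size_tuple // => lt_j.
by rewrite nth_nseq lt_j /row_bits (nth_mktuple _ _ (Ordinal lt_j)) A0.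
Qed.

Lemma row_bits_y : row_bits A y = half_row.
Proof.
apply: (@eq_from_nth _ false) => [|j]; rewrite ?size_tuple // => lt_j.
rewrite /row_bits (nth_mktuple _ _ (Ordinal lt_j)) Ay nth_cat !nth_nseq size_nseq /=.
by case: ltnP => //; case: ifP.
Qed.

Lemma good_row_bits i : good (row_bits A i).
Proof.
have H x : hamming (row_bits A x) (row_bits A i) \in [:: 0; 6; 12].
  have [-> | xi] := eqVneq x i; first by rewrite hamming_xx.
  by rewrite inE hamming_row_bits ?orbT.
by rewrite /good -row_bits0 -row_bits_y; apply/and3P; split; [exact: H | exact: H |].
Qed.

Lemma key1E i k (lt_k : k < 12) : k < 6 ->
  nth false (key (row_bits A i)).1 k = A i (Ordinal lt_k).
Proof.
by move=> lt6; rewrite /= nth_take // (nth_mktuple _ _ (Ordinal lt_k)).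
Qed.

(** Two rows with the same key of weight 3 would, together with [y] and the row 1^12, show 111 four
    times in three of the first six columns, where strength 3 allows three. Any other key determines
    its row, and distinct rows are at distance 6 or 12. *)
Lemma key_inj : injective (fun i => key (row_bits A i)).
Proof.
move=> x x' eq_key; apply/eqP/contraT => xx'.
have {}eq_key : key (row_bits A x) = key (row_bits A x') by [].
have [_ _ wt3] := goodP (size_row_bits _ _) (good_row_bits x).
have [_ _ wt3'] := goodP (size_row_bits _ _) (good_row_bits x').
have {wt3'} wt3 : count id (key (row_bits A x)).1 = 3.
  case: wt3 => // Ex; case: wt3'; first by rewrite -eq_key.
  rewrite -eq_key -Ex => E'; have := hamming_row_bits CA xx'.
  by rewrite E' hamming_xx.
have [a [b [c [U lt6 abc]]]] := weight3_support wt3.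
have size_key : size (key (row_bits A x)).1 = 6 by rewrite size_takel ?size_tuple.
rewrite size_key in lt6; move: lt6 abc => /and4P[/= a6 b6 c6 _] /and4P[xa xb xc _].
have [a12 b12 c12] := And3 (ltn_trans a6 (isT : 6 < 12))
  (ltn_trans b6 (isT : 6 < 12)) (ltn_trans c6 (isT : 6 < 12)).
have [t tP] := exists_antipode CA 0%R.
pose f i := [&& A i (Ordinal a12), A i (Ordinal b12) & A i (Ordinal c12)].
have sum_f : \sum_i f i = 3.
  by rewrite [LHS](@sum_triple _ CA _ (fun u v w => [&& u, v & w] : nat)) ?big_bool.
have fx : f x by rewrite /f -!(key1E x) // xa xb xc.
have fx' : f x' by rewrite /f -!(key1E x') // -eq_key xa xb xc.
have fy : f y by rewrite /f !Ay a6 b6 c6.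
have ft : f t by rewrite /f !tP !A0.
have x_not z : (key (row_bits A z)).1 = nseq 6 true -> (x != z) && (x' != z).
  move=> Ez; move: wt3; apply: contra_eqT => /nandP[]/negbNE/eqP E.
    by rewrite E Ez.
  by rewrite eq_key E Ez.
have ones z : (forall k : 'I_12, k < 6 -> A z k) -> (key (row_bits A z)).1 = nseq 6 true.
  move=> z1; apply: (@eq_from_nth _ false).
    by rewrite size_takel ?size_tuple.
  rewrite size_takel ?size_tuple // => k k6.
  rewrite (key1E _ (ltn_trans k6 (isT : 6 < 12))) //.
  by rewrite nth_nseq k6 z1.
have /andP[xy x'y] := x_not y (ones y (fun k k6 => etrans (Ay k) k6)).
have /andP[xt x't] := x_not t (ones t (fun k _ => etrans (tP k) (congr1 negb (A0 k)))).
have yt : y != t by apply/eqP => E; have := Ay ord_max; rewrite E tP A0.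
have Uxt : uniq [:: x; x'; y; t] by rewrite /= !inE !negb_or xx' xy xt x'y x't yt.
have : {subset [:: x; x'; y; t] <= enum f}.
  by move=> z; rewrite mem_enum !inE => /or4P[]/eqP->.
move/(uniq_leq_size Uxt); rewrite -cardE -sum1_card big_mkcond /=.
by rewrite (eq_bigr (fun i => f i : nat)) ?sum_f.
Qed.

(** Distinct keys of 24 rows, taken from a list of 24, exhaust it. *)
Lemma perm_keys : perm_eq keys [tuple key (row_bits A i) | i < 24].
Proof.
have Uk : uniq [tuple key (row_bits A i) | i < 24].
  by apply/tuple_uniqP => i j; rewrite !tnth_mktuple => /key_inj.
have sub : {subset [tuple key (row_bits A i) | i < 24] <= keys}.
  by move=> _ /mapP[i _ ->]; have [] := goodP (size_row_bits _ _) (good_row_bits i).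
have le_size : size keys <= size [tuple key (row_bits A i) | i < 24].
  by rewrite size_keys size_tuple.
have [_ eq_mem] := uniq_min_size Uk sub le_size.
apply: uniq_perm Uk _ => [|k]; last by rewrite eq_mem.
by have /andP[] := keys_check.
Qed.
End Normalized.

(** * Arrays whose rows are sorted by key *)

Lemma antisym_col_inj : injective antisym_col.
Proof.
move=> u v E; have : size u + size u = size v + size v.
  by have := congr1 size E; rewrite !size_cat !size_rev !size_map.
rewrite !addnn => /double_inj size_uv.
by move/eqP: E; rewrite eqseq_cat // => /andP[/eqP].
Qed.

Section Sorted.
Variable A : 'M[bool]_(24, 12).
Hypothesis CA : covering_array 4 A.
Hypothesis good_A : forall i, good (row_bits A i).
Hypothesis keyA : forall i : 'I_24, key (row_bits A i) = nth ([::], false) keys i.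

Lemma col_bits_low j : j < 6 -> forall lt_j : j < 12,
  col_bits A (Ordinal lt_j) = nth [::] pattern_cols j.
Proof.
move=> j6 lt_j; rewrite (nth_map 0) ?size_iota // nth_iota // add0n.
apply: (@eq_from_nth _ false) => [|i]; rewrite size_tuple // => lt_i.
rewrite (nth_map [::]) // /col_bits (nth_mktuple _ _ (Ordinal lt_i)).
have -> : nth [::] patterns i = (nth ([::], false) keys i).1.
  by rewrite nth_zip.
rewrite -(keyA (Ordinal lt_i)) nth_take //.
by rewrite (nth_mktuple _ _ (Ordinal lt_j)).
Qed.

Lemma special_row i (d : 'I_12) : 6 <= d ->
  count id (nth ([::], false) keys i).1 != 3 -> forall lt_i : i < 24,
  A (Ordinal lt_i) d = (nth ([::], false) keys i).2.
Proof.
move=> d6 wt lt_i; pose r := row_bits A (Ordinal lt_i).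
have -> : A (Ordinal lt_i) d = nth false r d by rewrite (nth_mktuple _ _ d).
have [_ _] := goodP (size_row_bits _ _) (good_A (Ordinal lt_i)).
rewrite (keyA (Ordinal lt_i)) => -[/eqP|]; first by rewrite (negbTE wt).
rewrite -/r => ->; rewrite nth_cat nth_nseq.
have -> : size (nth ([::], false) keys i).1 = 6.
  by rewrite -(keyA (Ordinal lt_i)) size_takel // size_tuple.
by rewrite ltnNge d6 /= ltn_subLR // ltn_ord.
Qed.

(** The opposite of row [i] occurs in the array, and its key, the opposite one, stands only at
    position [23 - i]. *)
Lemma antisym_rows i (d : 'I_12) : A (rev_ord i) d = ~~ A i d.
Proof.
have [i' i'P] := exists_antipode CA i.
have rowE : row_bits A i' = map negb (row_bits A i).
  by rewrite /row_bits /= -map_comp; apply: eq_map.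
have [_ keyN _] := goodP (size_row_bits _ _) (good_A i).
have /andP[Uk /eqP oppE] := keys_check.
suff -> : rev_ord i = i' by [].
apply/val_inj/eqP; rewrite -(nth_uniq ([::], false) _ _ Uk) ?ltn_ord //.
rewrite -(keyA i') rowE keyN keyA -(nth_map _ ([::], false)) ?ltn_ord // oppE.
by rewrite nth_rev ?ltn_ord.
Qed.

(** Strength 2 gives distance 12 to the first six columns, opposite rows give the antisymmetry, and
    the first two rows give the leading zeros. *)
Lemma col_bits_high (d : 'I_12) : 6 <= d -> col_bits A d \in col_candidates.
Proof.
move=> d6; set v := col_bits A d; have size_v : size v = 24 by rewrite size_tuple.
rewrite mem_filter; apply/andP; split.
  apply/allP => c /(nthP [::])[j]; rewrite size_map size_iota => j6 <-.
  have lt_j := ltn_trans j6 (isT : 6 < 12).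
  rewrite -(col_bits_low j6 lt_j) hamming_mktuple sum_addb_col //.
  by apply: contraTneq d6 => <-; rewrite -ltnNge.
have vE : v = antisym_col (take 12 v).
  rewrite -{1}(cat_take_drop 12 v); congr (_ ++ _).
  have size_h : size (map negb (take 12 v)) = 12 by rewrite size_map size_takel ?size_v.
  apply: (@eq_from_nth _ false); first by rewrite size_drop size_rev size_h size_v.
  rewrite size_drop size_v => i lt_i; rewrite nth_drop nth_rev ?size_h //.
  have lt_i' : 12 - i.+1 < 24 by rewrite (leq_ltn_trans (leq_subr _ _)).
  rewrite (nth_map false) ?size_takel ?size_v //; last by rewrite ltn_subrL.
  rewrite nth_take ?ltn_subrL // /v /col_bits (nth_mktuple _ _ (Ordinal lt_i')).
  rewrite -antisym_rows.
  have lt_i2 : 12 + i < 24 by rewrite (ltn_add2l 12).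
  rewrite (nth_mktuple _ _ (Ordinal lt_i2)); congr (A _ _); apply: val_inj => /=.
  by lia.
have v0 : nth false v 0 = false.
  by rewrite (nth_mktuple _ _ (Ordinal (isT : 0 < 24))) special_row.
have v1 : nth false v 1 = false.
  by rewrite (nth_mktuple _ _ (Ordinal (isT : 1 < 24))) special_row.
rewrite vE; case: v size_v v0 v1 {vE} => [|a [|b w]] // [size_w] v0 v1.
apply/mapP; exists (take 10 w); first by rewrite mem_bitseqs size_takel ?size_w.
by move: v0 v1 => /= -> ->.
Qed.

Lemma sorted_equiv_base : ca_equiv A (mx_of_cols (base_cols 0)).
Proof.
pose cols : seq bitseq := [tuple col_bits A j | j < 12].
have size_cols : size cols = 12 by rewrite size_tuple.
have colsE j (lt_j : j < 12) : nth [::] cols j = col_bits A (Ordinal lt_j).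
  exact: (nth_mktuple _ _ (Ordinal lt_j)).
pose hi := drop 6 cols.
have size_hi : size hi = 6 by rewrite size_drop size_cols.
have hiP v : v \in hi -> exists2 j : 'I_12, 6 <= j & v = col_bits A j.
  case/(nthP [::]) => j; rewrite size_hi => j6 <-.
  have lt_j : 6 + j < 12 by rewrite (ltn_add2l 6).
  by exists (Ordinal lt_j); rewrite ?leq_addr // nth_drop colsE.
have orth (j k : 'I_12) : j != k -> half_apart (col_bits A j) (col_bits A k).
  by move=> jk; rewrite /half_apart hamming_mktuple sum_addb_col.
have col_inj : injective (col_bits A).
  move=> j k E; apply/eqP/contraT => /orth; rewrite E /half_apart.
  by rewrite hamming_xx.
have Uhi : uniq hi.
  by apply/drop_uniq/tuple_uniqP => j k; rewrite !tnth_mktuple => /col_inj.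
have lowE : take 6 cols = pattern_cols.
  apply: (@eq_from_nth _ [::]) => [|j]; rewrite size_takel ?size_cols // => j6.
  by rewrite nth_take // (colsE _ (ltn_trans j6 (isT : 6 < 12))) col_bits_low.
have Ucand : uniq col_candidates.
  by rewrite filter_uniq // map_inj_uniq ?bitseqs_uniq // => u w /antisym_col_inj[].
(* The last six columns are pairwise orthogonal candidates, hence one of the completions up to
   order. *)
have [|| c c_in hi_c] := @cliquesP _ half_apart col_candidates hi Ucand Uhi.
- by move=> _ /hiP[j j6 ->]; exact: col_bits_high.
- move=> _ _ /hiP[j _ ->] /hiP[k _ ->] jk; apply: orth.
  by apply: contraNneq jk => ->.
have A_c : ca_equiv A (mx_of_cols (pattern_cols ++ c)).
  apply: ca_equiv_cols; rewrite -[X in perm_eq _ X](cat_take_drop 6) -/cols lowE.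
  by rewrite perm_cat2l perm_sym.
rewrite size_hi in c_in; have := index_mem c completions; rewrite [X in _ = X]c_in.
have := nth_index [::] c_in; rewrite size_completions.
case: (index c completions) => [|[|//]] E _.
  by rewrite /base_cols E.
by apply: ca_equiv_trans base_equiv; rewrite /base_cols E.
Qed.
End Sorted.

(** * Reduction of every covering array to the first base array *)

Lemma covering_equiv_base A :
  covering_array 4 A -> ca_equiv A (mx_of_cols (base_cols 0)).
Proof.
(* Complementing the columns where row 0 has a 1 turns that row into 0^12. *)
move=> CA; pose B : 'M_(24, 12) := (\matrix_(i, j) (A i j (+) A 0 j))%R.
have AB : ca_equiv A B := ca_equiv_compl (A 0%R) A.
have CB := covering_array_equiv AB CA.
have B0 j : B 0%R j = false by rewrite mxE addbb.
(* Rows 1 and 2 cannot both be opposite to row 0, as they would coincide; so one of them has weight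
   6. *)
have [y wt_y] : exists y, \sum_j B y j = 6.
  have [H1|H1] := row_distance CB (isT : 0%R != 1%R :> 'I_24).
    by exists 1%R; rewrite -[RHS]H1; apply: eq_bigr => j _; rewrite B0.
  have [H2|H2] := row_distance CB (isT : 0%R != 2%R :> 'I_24).
    by exists 2%R; rewrite -[RHS]H2; apply: eq_bigr => j _; rewrite B0.
  have := hamming_row_bits CB (isT : 1%R != 2%R :> 'I_24).
  have -> : row_bits B 1%R = row_bits B 2%R.
    by rewrite /row_bits /=; apply: eq_map => j; rewrite H1 H2.
  by rewrite hamming_xx.
have /tuple_permP[s sE] : perm_eq half_row [tuple B y j | j < 12].
  have cT : count id [tuple B y j | j < 12] = 6.
    by rewrite -[RHS]wt_y count_map -sum1_count big_mkcond big_enum; apply: eq_bigr.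
  have cF : count negb [tuple B y j | j < 12] = 6.
    by have := count_predC id [tuple B y j | j < 12]; rewrite size_tuple cT => -[].
  have cb b : count_mem b [tuple B y j | j < 12] = 6.
    by case: b; [rewrite -[RHS]cT | rewrite -[RHS]cF]; apply: eq_count => -[].
  by apply/allP => b _; apply/eqP; rewrite [RHS]cb; case: b.
(* The columns where [y] has a 1 come first. *)
pose C := col_perm s B; have BC : ca_equiv B C by exact/rt_step/Step_col.
have CC := covering_array_equiv BC CB.
have C0 j : C 0%R j = false by rewrite mxE B0.
have Cy (j : 'I_12) : C y j = (j < 6).
  have := congr1 (nth false ^~ j) sE; rewrite [C y j]mxE nth_mktuple tnth_mktuple => <-.
  by rewrite nth_cat !nth_nseq size_nseq; case: ltnP => //; case: ifP.
have /tuple_permP[p pE] := perm_keys CC C0 Cy.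
(* The rows now follow the order of [keys]. *)
pose D := row_perm p C; have CD : ca_equiv C D by exact/rt_step/Step_row.
have rowD i : row_bits D i = row_bits C (p i).
  by rewrite /row_bits /=; apply: eq_map => j; rewrite mxE.
apply: (ca_equiv_trans AB); apply: (ca_equiv_trans BC); apply: (ca_equiv_trans CD).
apply: sorted_equiv_base => [|i|i]; first exact: (covering_array_equiv CD CC).
  by rewrite rowD; exact: (good_row_bits CC C0 Cy).
by rewrite rowD pE nth_mktuple tnth_mktuple.
Qed.

Theorem theorem5p7 :
  (exists A : 'M[bool]_(24, 12), covering_array 4 A) /\
  (forall A B : 'M[bool]_(24, 12),
     covering_array 4 A -> covering_array 4 B -> ca_equiv A B).
Proof.
split=> [|A B CA CB]; first by exists (mx_of_cols (base_cols 0)); exact: base_covering.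
apply: ca_equiv_trans (covering_equiv_base CA) _.
exact/ca_equiv_sym/covering_equiv_base.
Qed.
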